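(* Let $\mathcal{K}=(\Sigma,\to,\ell)$ be a Kripke structure with $\Sigma$ finite. Every run of the logical algorithm ESim on input $\langle P_\ell,\mathrm{id}\rangle$ terminates, and if $\langle P,\trianglelefteq\rangle$ is its output then for all $s,t\in\Sigma$: $t$ simulates $s$ (i.e. $s\le t$) if and only if $P(s)\trianglelefteq P(t)$.
   Context: A Kripke structure $(\Sigma,\to,\ell)$ has state set $\Sigma$, transition relation $\to\subseteq\Sigma\times\Sigma$ and labeling $\ell:\Sigma\to\wp(AP)$. A relation $R\subseteq\Sigma\times\Sigma$ is a simulation if whenever $(s,s')\in R$: $\ell(s)=\ell(s')$, and for every $t$ with $s\to t$ there is $t'$ with $s'\to t'$ and $(t,t')\in R$; $s\le t$ means $(s,t)$ belongs to some simulation. $P_\ell=\{\{s'\mid \ell(s')=\ell(s)\}\mid s\in\Sigma\}$. A PR $\langle P,\trianglelefteq\rangle$ is a partition $P$ of $\Sigma$ with a relation $\trianglelefteq\subseteq P\times P$; $\mathrm{id}$ is the identity relation on $P_\ell$; $P(s)$ is the block containing $s$. $\mathrm{pre}(T)=\{s\mid\exists t\in T.\ s\to t\}$; $S_1\to^{\exists}S_2$ means some $s_1\in S_1$, $s_2\in S_2$ satisfy $s_1\to s_2$; $\mu_{\mathcal{P}}(X)=\bigcup\{C\in P\mid\exists s\in X.\ P(s)\trianglelefteq C\}$. $\mathrm{Split}(P,S)$ replaces each block $B$ by the nonempty sets among $B\cap S$, $B\setminus S$; for a refinement $P'$ of $P$ and $D\in P'$, $\mathrm{parent}_P(D)$ is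 the block of $P$ containing $D$. A block $C\in P$ is a partition refiner of $\mathcal{P}=\langle P,\trianglelefteq\rangle$ if some $B\in P$ meets both $\mathrm{pre}(\mu_{\mathcal{P}}(C))$ and its complement; $C$ is a relation refiner if there are $B,D\in P$ with $B\to^{\exists}C$, $B\trianglelefteq D$ and not $D\to^{\exists}\mu_{\mathcal{P}}(C)$. The logical algorithm ESim maintains a current PR $\mathcal{P}=\langle P,\trianglelefteq\rangle$, initially $\langle P_\ell,\mathrm{id}\rangle$, and uses two operations. PStabilize: while the current PR has some partition refiner $C$ (chosen arbitrarily), let $S=\mathrm{pre}(\mu_{\mathcal{P}}(C))$, replace $P$ by $P'=\mathrm{Split}(P,S)$ and $\trianglelefteq$ by $\{(D,E)\in P'\times P'\mid \mathrm{parent}_P(D)\trianglelefteq\mathrm{parent}_P(E)\}$. RStabilize: replace $\trianglelefteq$ by $\trianglelefteq\setminus\{(B,D)\mid B\trianglelefteq D,\ \exists C\in P.\ B\to^{\exists}C \text{ and not } D\to^{\exists}\mu_{\mathcal{P}}(C)\}$ (all removals computed with respect to the PR at the start of the operation). ESim applies PStabilize, then alternately applies RStabilize and PStabilize, stopping as soon as an application leaves the current PR unchanged, and outputs the current PR.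
   Formalization: ESim is taken to stop when a whole round (RStabilize then PStabilize) leaves the PR unchanged; stopping after any single unchanged application, as literally worded, can give a wrong output when PStabilize is idle after a changing RStabilize. *)

(* Defs.v *)
(* MathComp, with asbool / classical sets from mathcomp-classical. *)
From mathcomp Require Import all_boot boolp.
From mathcomp Require classical_sets.

Set Implicit Arguments.
Unset Strict Implicit.
Unset Printing Implicit Defensive.

(* AP is an arbitrary, possibly infinite, type, hence classical sets of labels;
   subsets of Sigma are finite sets. *)
Record kripke (AP : Type) (Sigma : finType) := Kripke {
  trans : rel Sigma;
  label : Sigma -> classical_sets.set AP }.

Section Simulation.
Context {AP : Type} {Sigma : finType} (K : kripke AP Sigma).

Definition simulation (R : Sigma -> Sigma -> Prop) : Prop :=
  forall s s', R s s' ->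
    label K s = label K s' /\
    (forall t, trans K s t -> exists2 t', trans K s' t' & R t t').

Definition sim_le (s t : Sigma) : Prop := exists2 R, simulation R & R s t.

Definition pre (T : {set Sigma}) : {set Sigma} :=
  [set s | [exists t in T, trans K s t]].

Definition ex_trans (S1 S2 : {set Sigma}) : bool :=
  [exists s1 in S1, exists s2 in S2, trans K s1 s2].

Definition label_partition : {set {set Sigma}} :=
  [set [set s' | `[< label K s' = label K s >]] | s : Sigma].

Lemma label_partitionP : partition label_partition [set: Sigma].
Proof.
pose R := [rel s s' | `[< label K s' = label K s >]].
suff -> : label_partition = equivalence_partition R [set: Sigma].
  apply: equivalence_partitionP => x y z _ _ _; split; first exact/asboolP.
  by move=> /asboolP /= e; rewrite e.
by apply/setP => B; apply/imsetP/imsetP => -[s _ ->]; exists s => //;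
  apply/setP => t; rewrite !inE.
Qed.

End Simulation.

Section PartitionRelation.
Context {Sigma : finType}.
Implicit Types (P : {set {set Sigma}}) (S X B C D E : {set Sigma}).

Record PR := MkPR {
  blocks : {set {set Sigma}};
  ord : {set {set Sigma} * {set Sigma}};
  blocksP : partition blocks [set: Sigma];
  ordP : ord \subset setX blocks blocks }.

Definition Split P S : {set {set Sigma}} :=
  ([set B :&: S | B in P] :|: [set B :\: S | B in P]) :\ set0.

Lemma SplitP P S :
  partition P [set: Sigma] -> partition (Split P S) [set: Sigma].
Proof.
move=> /and3P[/eqP cP /trivIsetP tP _].
have in_Split D : D \in Split P S -> exists2 B, B \in P &
    D = B :&: S \/ D = B :\: S.
  by rewrite !inE => /andP[_ /orP[]] /imsetP[B BP ->]; exists B; auto.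
apply/and3P; split; last by rewrite !inE eqxx.
- apply/eqP/setP => x; rewrite [RHS]inE.
  have : x \in cover P by rewrite cP inE.
  move=> /bigcupP[B BP xB]; apply/bigcupP; have [xS|xS] := boolP (x \in S).
    have xD : x \in B :&: S by rewrite inE xB xS.
    exists (B :&: S) => //; rewrite in_setD1 in_setU; apply/andP; split.
      by apply/set0Pn; exists x.
    by apply/orP; left; apply/imsetP; exists B.
  have xD : x \in B :\: S by rewrite inE xB xS.
  exists (B :\: S) => //; rewrite in_setD1 in_setU; apply/andP; split.
    by apply/set0Pn; exists x.
  by apply/orP; right; apply/imsetP; exists B.
- apply/trivIsetP => D E /in_Split[B BP hD] /in_Split[C CP hE] neDE.
  apply/pred0P => x; apply/negbTE/negP => /= /andP[xD xE].
  have xB : x \in B by case: hD xD => ->; rewrite inE => /andP[].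
  have xC : x \in C by case: hE xE => ->; rewrite inE => /andP[].
  have eBC : B = C.
    apply/eqP/negPn/negP => /(tP _ _ BP CP) /pred0P /(_ x) /=.
    by rewrite xB xC.
  move/eqP: neDE; apply; move: xD xE; rewrite -eBC in hE.
  by case: hD => ->; case: hE => -> //; rewrite !inE xB; case: (x \in S).
Qed.

(* Meant for D a block of a refinement of P: then exactly one block of P
   contains D. *)
Definition parent P D : {set Sigma} :=
  odflt set0 [pick B in P | D \subset B].

Definition mu (Q : PR) X : {set Sigma} :=
  \bigcup_(C in blocks Q
             | [exists s in X, (pblock (blocks Q) s, C) \in ord Q]) C.

End PartitionRelation.

Arguments PR : clear implicits.

Section ESim.
Context {AP : Type} {Sigma : finType} (K : kripke AP Sigma).
Implicit Types (Q : PR Sigma) (C : {set Sigma}).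

Definition initial_ord : {set {set Sigma} * {set Sigma}} :=
  [set (B, B) | B in label_partition K].

Lemma initial_ordP :
  initial_ord \subset setX (label_partition K) (label_partition K).
Proof. by apply/subsetP => _ /imsetP[B BP ->]; rewrite inE /= BP. Qed.

Definition initial_PR : PR Sigma := MkPR (label_partitionP K) initial_ordP.

Definition partition_refiner Q C : Prop :=
  C \in blocks Q /\
  exists2 B, B \in blocks Q &
    B :&: pre K (mu Q C) != set0 /\ B :&: ~: pre K (mu Q C) != set0.

Definition split_blocks Q C : {set {set Sigma}} :=
  Split (blocks Q) (pre K (mu Q C)).

Definition split_ord Q C : {set {set Sigma} * {set Sigma}} :=
  [set DE in setX (split_blocks Q C) (split_blocks Q C)
    | (parent (blocks Q) DE.1, parent (blocks Q) DE.2) \in ord Q].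

Lemma split_ordP Q C :
  split_ord Q C \subset setX (split_blocks Q C) (split_blocks Q C).
Proof. by apply/subsetP => DE; rewrite inE => /andP[]. Qed.

Definition split_PR Q C : PR Sigma :=
  MkPR (SplitP (pre K (mu Q C)) (blocksP Q)) (split_ordP Q C).

Definition stable_ord Q : {set {set Sigma} * {set Sigma}} :=
  ord Q :\: [set BD in ord Q | [exists C in blocks Q,
               ex_trans K BD.1 C && ~~ ex_trans K BD.2 (mu Q C)]].

Lemma stable_ordP Q : stable_ord Q \subset setX (blocks Q) (blocks Q).
Proof. exact: subset_trans (subsetDl _ _) (ordP Q). Qed.

Definition RStabilize Q : PR Sigma := MkPR (blocksP Q) (stable_ordP Q).

(* Control points of ESim.
   InPStabilize None Q     : inside the initial PStabilize, current PR Q;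
   InPStabilize (Some Q0) Q: inside the PStabilize of a round (RStabilize then
                             PStabilize) that was started on the PR Q0;
   AtRStabilize Q          : a new round is about to start on Q;
   Output Q                : ESim has stopped with output Q. *)
Inductive config : Type :=
  | InPStabilize of option (PR Sigma) & PR Sigma
  | AtRStabilize of PR Sigma
  | Output of PR Sigma.

(* ESim stops when a whole round leaves the current PR unchanged.  Stopping as
   soon as the PStabilize of a round changes nothing, although its RStabilize
   did, would be incorrect: take edges b -> c, d -> e, d -> m, c -> x with
   label classes {b, d}, {c, e}, {x}, {m}.  The initial PStabilize makes all
   blocks singletons, and the first RStabilize removes ({d}, {b}) and
   ({c}, {e}) but keeps ({b}, {d}), while d does not simulate b. *)
Inductive step : config -> config -> Prop :=
  | StepSplit old Q C : partition_refiner Q C ->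
      step (InPStabilize old Q) (InPStabilize old (split_PR Q C))
  | StepInitialDone Q : (forall C, ~ partition_refiner Q C) ->
      step (InPStabilize None Q) (AtRStabilize Q)
  | StepRStabilize Q :
      step (AtRStabilize Q) (InPStabilize (Some Q) (RStabilize Q))
  | StepRoundChanged Q0 Q : (forall C, ~ partition_refiner Q C) -> Q <> Q0 ->
      step (InPStabilize (Some Q0) Q) (AtRStabilize Q)
  | StepRoundUnchanged Q0 Q : (forall C, ~ partition_refiner Q C) -> Q = Q0 ->
      step (InPStabilize (Some Q0) Q) (Output Q).

(* The first n steps of r form a run (prefix) of ESim. *)
Definition is_run (r : nat -> config) (n : nat) : Prop :=
  r 0 = InPStabilize None initial_PR /\
  forall i, i < n -> step (r i) (r i.+1).

(* No run is infinite, and a run can only get stuck by producing an output. *)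
Definition every_run_terminates : Prop :=
  (forall r, ~ (forall n, is_run r n)) /\
  (forall r n, is_run r n -> (forall c, ~ step (r n) c) ->
     exists Q, r n = Output Q).

Definition is_output Q : Prop := exists r n, is_run r n /\ r n = Output Q.

End ESim.

(* Main.v *)
Require Import Defs.
From mathcomp Require Import all_boot boolp.
From mathcomp Require Import zify.

Set Implicit Arguments.
Unset Strict Implicit.
Unset Printing Implicit Defensive.

(* A PR induces the relation [R s t := P(s) <= P(t)] on states.  Splitting keeps
   it, because the new order compares parents, and RStabilize shrinks it.  Being
   a preorder, refining label equality and containing the simulation preorder
   are all preserved; for the last one, RStabilize is only ever applied to a
   PR without partition refiner.  When a round changes nothing there is no
   relation refiner either, and [R] is then itself a simulation.  Each
   non-trivial operation removes a pair from [R] or from the same-block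
   relation, whence termination. *)

Definition state_rel {Sigma : finType} (Q : PR Sigma) : rel Sigma :=
  fun s t => (pblock (blocks Q) s, pblock (blocks Q) t) \in ord Q.

(** * Blocks, order and [mu] expressed through states *)

Section PartitionRelations.
Context {Sigma : finType}.
Implicit Types (Q : PR Sigma) (B C D S X : {set Sigma}) (s t x y : Sigma).

Lemma mem_pblock_blocks Q s : s \in pblock (blocks Q) s.
Proof. by rewrite mem_pblock (cover_partition (blocksP Q)) inE. Qed.

Lemma pblock_blocks Q s : pblock (blocks Q) s \in blocks Q.
Proof. by rewrite pblock_mem // (cover_partition (blocksP Q)) inE. Qed.

Lemma pblock_blocksE Q B s : B \in blocks Q -> s \in B ->
  pblock (blocks Q) s = B.
Proof. exact: def_pblock (partition_trivIset (blocksP Q)). Qed.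

Lemma blocks_inhabited Q B : B \in blocks Q -> exists s, s \in B.
Proof.
move=> BQ; apply/set0Pn; apply: contraTneq BQ => ->.
by have /and3P[] := blocksP Q.
Qed.

Lemma ord_blocks Q B D : (B, D) \in ord Q -> B \in blocks Q /\ D \in blocks Q.
Proof. by move=> /(subsetP (ordP Q)); rewrite inE => /andP[]. Qed.

(** The two remaining fields are proofs of Boolean equations, which are irrelevant. *)
Lemma PR_eq Q Q' : blocks Q = blocks Q' -> ord Q = ord Q' -> Q = Q'.
Proof.
case: Q Q' => P o pP oP [P' o' pP' oP'] /= eP eo.
case: _ / eP pP' oP' => pP' oP'.
by case: _ / eo oP' => oP'; congr MkPR; exact: bool_irrelevance.
Qed.

Lemma mem_mu Q X t :
  (t \in mu Q X) = [exists s in X, state_rel Q s t].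
Proof.
apply/bigcupP/exists_inP => [[C /andP[CQ /exists_inP[s sX sC]] tC]|[s sX st]].
  by exists s; rewrite // /state_rel (pblock_blocksE CQ tC).
exists (pblock (blocks Q) t); last exact: mem_pblock_blocks.
by rewrite pblock_blocks; apply/exists_inP; exists s.
Qed.

Lemma mem_mu_pblock Q s t :
  (t \in mu Q (pblock (blocks Q) s)) = state_rel Q s t.
Proof.
rewrite mem_mu; apply/exists_inP/idP => [[x xs]|st].
  by rewrite /state_rel (pblock_blocksE (pblock_blocks Q s) xs).
by exists s => //; exact: mem_pblock_blocks.
Qed.

Lemma mem_Split (P : {set {set Sigma}}) S D : D \in Defs.Split P S ->
  exists2 B, B \in P & D = B :&: S \/ D = B :\: S.
Proof. by rewrite !inE => /andP[_ /orP[]] /imsetP[B BP ->]; exists B; auto. Qed.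

End PartitionRelations.

Section ESimCorrect.
Context {AP : Type} {Sigma : finType} (K : kripke AP Sigma).
Implicit Types (Q : PR Sigma) (B C D S X : {set Sigma}) (s t x y : Sigma).

Lemma preP X s : reflect (exists2 t, t \in X & trans K s t) (s \in pre K X).
Proof. by rewrite inE; exact: exists_inP. Qed.

Lemma ex_transP (S1 S2 : {set Sigma}) : reflect
  (exists s1 s2, [/\ s1 \in S1, s2 \in S2 & trans K s1 s2]) (ex_trans K S1 S2).
Proof.
apply: (iffP exists_inP) => [[s1 s1S /exists_inP[s2 s2S tr]]|[s1 [s2 [? ? ?]]]].
  by exists s1, s2.
by exists s1 => //; apply/exists_inP; exists s2.
Qed.

Lemma sim_le_label s t : sim_le K s t -> label K s = label K t.
Proof. by move=> [R simR /simR[]]. Qed.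

Lemma sim_le_trans s t s' : sim_le K s t -> trans K s s' ->
  exists2 t', trans K t t' & sim_le K s' t'.
Proof.
move=> [R simR Rst] /(proj2 (simR _ _ Rst))[t' tt' Rst'].
by exists t' => //; exists R.
Qed.

(** * Effect of splitting and of [RStabilize] on states *)

Lemma pblock_split Q C s : pblock (blocks (split_PR K Q C)) s \subset
  pblock (blocks Q) s.
Proof.
have sD := mem_pblock_blocks (split_PR K Q C) s.
have /mem_Split[B BQ DB] := pblock_blocks (split_PR K Q C) s.
have DsB : pblock (blocks (split_PR K Q C)) s \subset B.
  by case: DB => ->; rewrite ?subsetIl ?subsetDl.
by rewrite (pblock_blocksE BQ (subsetP DsB _ sD)).
Qed.

Lemma mem_pblock_split Q C s t :
  t \in pblock (blocks (split_PR K Q C)) s ->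
  (s \in pre K (mu Q C)) = (t \in pre K (mu Q C)).
Proof.
have sD := mem_pblock_blocks (split_PR K Q C) s.
have /mem_Split[B BQ DB] := pblock_blocks (split_PR K Q C) s.
move=> tD; move: sD tD.
case: DB => ->; rewrite [s \in _]inE [t \in _]inE.
  by move=> /andP[_ ->] /andP[_ ->].
by move=> /andP[/negPf -> _] /andP[/negPf -> _].
Qed.

Lemma parent_pblock_split Q C s :
  parent (blocks Q) (pblock (blocks (split_PR K Q C)) s) = pblock (blocks Q) s.
Proof.
rewrite /parent; case: pickP => [B /andP[BQ sB]|] /=; last first.
  (* The default [set0] of [parent] is never reached: the old block of [s] is a candidate. *)
  move=> /(_ (pblock (blocks Q) s)).
  by rewrite /= pblock_blocks pblock_split.
apply/esym/pblock_blocksE => //.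
exact: subsetP sB _ (mem_pblock_blocks (split_PR K Q C) s).
Qed.

Lemma state_rel_split Q C : state_rel (split_PR K Q C) =2 state_rel Q.
Proof.
move=> s t; rewrite /state_rel [LHS]inE /= !parent_pblock_split inE /=.
by rewrite !(pblock_blocks (split_PR K Q C)).
Qed.

(** The block [C] in the removal test is the block of the target [y], and [mu] of that block is the
    set of states above [y]. *)
Lemma state_rel_RStabilizeP Q s t : reflect
  (state_rel Q s t /\ forall x y, x \in pblock (blocks Q) s -> trans K x y ->
     exists x' y', [/\ x' \in pblock (blocks Q) t, trans K x' y'
       & state_rel Q y y'])
  (state_rel (RStabilize K Q) s t).
Proof.
rewrite /state_rel /= in_setD [in ~~ _]inE /= -/(state_rel Q s t).
apply: (iffP andP) => [[/nandP[/negP//|nref] Qst]|[Qst stab]]; split=> //.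
  move=> x y xs xy; move: nref; rewrite negb_exists.
  move=> /forallP /(_ (pblock (blocks Q) y)).
  rewrite pblock_blocks /= negb_and negbK => /orP[/negP[]|].
    apply/ex_transP; exists x, y; split=> //; exact: mem_pblock_blocks.
  move=> /ex_transP[x' [y' [x't]]]; rewrite mem_mu_pblock => yy' tr.
  by exists x', y'.
rewrite Qst /= negb_exists; apply/forallP => C; apply/negP.
move=> /andP[CQ /andP[/ex_transP[x [y [xs yC xy]]] /ex_transP[]]].
have [x' [y' [x't tr yy']]] := stab _ _ xs xy.
by exists x', y'; split=> //; rewrite mem_mu; apply/exists_inP; exists y.
Qed.

(** * Partition stability and the invariant properties *)

Definition partition_stable Q : Prop := forall C, ~ partition_refiner K Q C.

(** Otherwise the block of [y] would be a partition refiner, separating [x] from [x']; by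
    reflexivity [y] lies in [mu] of its own block. *)
Lemma partition_stable_trans Q x x' y : partition_stable Q ->
  reflexive (state_rel Q) -> x' \in pblock (blocks Q) x -> trans K x y ->
  exists2 y', trans K x' y' & state_rel Q y y'.
Proof.
move=> stQ reflQ x'x xy.
have [/preP[y']|x'N] := boolP (x' \in pre K (mu Q (pblock (blocks Q) y))).
  by rewrite mem_mu_pblock => yy' x'y'; exists y'.
case: (stQ (pblock (blocks Q) y)); split; first exact: pblock_blocks.
exists (pblock (blocks Q) x); first exact: pblock_blocks.
split; apply/set0Pn; last by exists x'; rewrite !inE in x'N *; rewrite x'x.
exists x; rewrite inE mem_pblock_blocks /=; apply/preP.
by exists y; rewrite // mem_mu_pblock.
Qed.

Record adequate Q : Prop := Adequate {
  adequate_refl : reflexive (state_rel Q);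
  adequate_trans : transitive (state_rel Q);
  adequate_label : forall s t, state_rel Q s t -> label K s = label K t;
  adequate_sim : forall s t, sim_le K s t -> state_rel Q s t }.

Lemma eq_adequate Q Q' : state_rel Q =2 state_rel Q' ->
  adequate Q -> adequate Q'.
Proof.
move=> eQ [rQ tQ lQ sQ]; split=> [s|t s u|s t|s t].
- by rewrite -eQ.
- by rewrite -!eQ; exact: tQ.
- by rewrite -eQ; exact: lQ.
- by rewrite -eQ; exact: sQ.
Qed.

Lemma adequate_initial : adequate (initial_PR K).
Proof.
have relE s t : state_rel (initial_PR K) s t =
    (pblock (blocks (initial_PR K)) s == pblock (blocks (initial_PR K)) t).
  apply/imsetP/eqP => [[B _ [-> ->]]//|<-].
  by eexists; first exact: (pblock_blocks (initial_PR K) s).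
have pbE s : pblock (blocks (initial_PR K)) s =
    [set s' | `[< label K s' = label K s >]].
  apply: pblock_blocksE; first by apply/imsetP; exists s.
  by rewrite inE; apply/asboolP.
split=> [s|t s u|s t|s t]; rewrite !relE.
- by [].
- by move=> /eqP-> /eqP->.
- rewrite !pbE => /eqP/setP/(_ s); rewrite !inE => e.
  by apply/asboolP; rewrite -e; apply/asboolP.
- by move=> /sim_le_label e; rewrite !pbE e.
Qed.

Lemma adequate_RStabilize Q : partition_stable Q -> adequate Q ->
  adequate (RStabilize K Q).
Proof.
move=> stQ [rQ tQ lQ sQ]; split=> [s|t s u|s t|s t].
- apply/state_rel_RStabilizeP; split=> // x y xs xy.
  by exists x, y; split.
- move=> /state_rel_RStabilizeP[st stab_st] /state_rel_RStabilizeP[tu stab_tu].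
  apply/state_rel_RStabilizeP; split; first exact: tQ tu.
  move=> x y xs /(stab_st _ _ xs)[x' [y' [x't]]].
  move=> /(stab_tu _ _ x't)[z [w [zu zw y'w]]] yy'.
  by exists z, w; split=> //; exact: tQ y'w.
- by move=> /state_rel_RStabilizeP[/lQ].
- move=> st; apply/state_rel_RStabilizeP; split; first exact: sQ.
  move=> x y xs xy.
  (* The move starts at some [x] in the block of [s]. Stability transfers it to [s], the simulation
     carries it on to [t], and transitivity composes the two. *)
  have sx : s \in pblock (blocks Q) x.
    by rewrite (pblock_blocksE (pblock_blocks Q s) xs) mem_pblock_blocks.
  have [y' sy' yy'] := partition_stable_trans stQ rQ sx xy.
  have [z tz /sQ y'z] := sim_le_trans st sy'.
  by exists t, z; rewrite mem_pblock_blocks; split=> //; exact: tQ y'z.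
Qed.

(** A fixpoint of [RStabilize] answers a move of [s] only from some state in the block of [t];
    stability moves that answer to [t] itself, so the relation is a simulation. *)
Lemma stable_sim_leP Q : partition_stable Q -> adequate Q ->
  state_rel Q =2 state_rel (RStabilize K Q) ->
  forall s t, sim_le K s t <-> state_rel Q s t.
Proof.
move=> stQ [rQ tQ lQ sQ] eQ s t; split; first exact: sQ.
move=> Qst; exists (state_rel Q) => // {Qst}s {}t st.
split=> [|s' ss']; first exact: lQ.
move: st; rewrite eQ => /state_rel_RStabilizeP[_ /(_ s s')].
rewrite mem_pblock_blocks => /(_ isT ss')[x [y [xt xy s'y]]].
have tx : t \in pblock (blocks Q) x.
  by rewrite (pblock_blocksE (pblock_blocks Q t) xt) mem_pblock_blocks.
have [z tz yz] := partition_stable_trans stQ rQ tx xy.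
by exists z => //; exact: tQ yz.
Qed.

(** During a round the relation stays the one [RStabilize] produced from [Q0], as splits do not
    alter it. Ending with [Q = Q0] therefore yields a fixpoint. *)
Definition config_inv (c : config) : Prop :=
  match c with
  | InPStabilize None Q => adequate Q
  | InPStabilize (Some Q0) Q =>
      adequate Q /\ state_rel Q =2 state_rel (RStabilize K Q0)
  | AtRStabilize Q => adequate Q /\ partition_stable Q
  | Output Q => [/\ adequate Q, partition_stable Q
                & state_rel Q =2 state_rel (RStabilize K Q)]
  end.

Lemma step_inv c c' : step K c c' -> config_inv c -> config_inv c'.
Proof.
case=> {c c'} [old Q C _|Q stQ|Q|Q0 Q stQ _|Q0 Q stQ eqQ] /=.
- have eQ : state_rel Q =2 state_rel (split_PR K Q C).
    by move=> s t; rewrite state_rel_split.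
  case: old => [Q0|]; last exact: eq_adequate.
  move=> [aQ eQ0]; split; first exact: eq_adequate aQ.
  by move=> s t; rewrite -eQ.
- by [].
- by move=> [aQ stQ]; split=> //; exact: adequate_RStabilize.
- by move=> [aQ _].
- by rewrite -eqQ => -[aQ eQ].
Qed.

(** * Termination *)

Definition potential Q : nat :=
  #|[set p : Sigma * Sigma | state_rel Q p.1 p.2]| +
  #|[set p : Sigma * Sigma | p.2 \in pblock (blocks Q) p.1]|.

Lemma potential_split Q C : partition_refiner K Q C ->
  potential (split_PR K Q C) < potential Q.
Proof.
move=> [_ [B BQ [/set0Pn[x] + /set0Pn[y]]]].
rewrite !in_setI in_setC => /andP[xB xS] /andP[yB yS].
rewrite /potential (eq_card (B := [set p | state_rel Q p.1 p.2])); last first.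
  by move=> p; rewrite !inE state_rel_split.
rewrite ltn_add2l; apply/proper_card/properP; split.
  by apply/subsetP => p; rewrite !inE; exact/subsetP/pblock_split.
(* Both states lie in [B], but the split puts them on different sides of the [pre] set. *)
exists (x, y); rewrite inE /= ?(pblock_blocksE BQ xB) //.
by apply/negP => /mem_pblock_split; rewrite xS (negPf yS).
Qed.

Lemma potential_RStabilize Q : RStabilize K Q <> Q ->
  potential (RStabilize K Q) < potential Q.
Proof.
move=> neQ; rewrite ltn_add2r; apply/proper_card/properP; split.
  by apply/subsetP => p; rewrite !inE => /state_rel_RStabilizeP[].
(* The blocks are unchanged, so the difference is a removed pair [(B, D)]; representatives exist
   since blocks are nonempty. *)
have /subsetPn[[B D] BDQ BDN] : ~~ (ord Q \subset ord (RStabilize K Q)).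
  apply/negP => sQ; apply/neQ/PR_eq => //; apply/eqP.
  by rewrite eqEsubset sQ subsetDl.
have [BQ DQ] := ord_blocks BDQ.
have [s sB] := blocks_inhabited BQ; have [t tD] := blocks_inhabited DQ.
by exists (s, t); rewrite inE /state_rel /= (pblock_blocksE BQ sB)
  (pblock_blocksE DQ tD).
Qed.

(* The offsets order the control points within a round; the factor 3 lets a
   drop of the potential pay for starting the next round. *)
Definition config_measure (c : config) : nat :=
  match c with
  | InPStabilize None Q => 3 * potential Q + 3
  | InPStabilize (Some Q0) Q =>
      3 * potential Q + (if `[< Q = Q0 >] then 1 else 3)
  | AtRStabilize Q => 3 * potential Q + 2
  | Output _ => 0
  end.

Lemma step_measure c c' : step K c c' -> config_measure c' < config_measure c.
Proof.
case=> {c c'} [old Q C /potential_split lt|Q _|Q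
    |Q0 Q _ /asboolPn/negPf neQ|Q0 Q _ _] /=.
- case: old => [Q0|]; last by lia.
  (* The split gains at least 3, while the offset grows by at most 2. *)
  by case: ifP => _; case: ifP => _; lia.
- by lia.
(* If nothing is removed, the offset falls from 2 to 1; otherwise the potential drop outweighs the
   rise from 2 to 3. *)
- case: asboolP => [->|/potential_RStabilize]; lia.
- by rewrite neQ; lia.
- by case: ifP => _; lia.
Qed.

Lemma every_run_terminatesP : every_run_terminates K.
Proof.
split=> [r run|r n _ stuck].
  have stepr n : step K (r n) (r n.+1) by exact: (run n.+1).2.
  have bound n : config_measure (r n) + n <= config_measure (r 0).
    by elim: n => [|n IHn]; [lia|have := step_measure (stepr n); lia].
  (* More steps than the initial measure allows. *)
  by have := bound (config_measure (r 0)).+1; lia.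
case: (r n) stuck => [old Q|Q|Q] stuck; last by exists Q.
- have stQ : partition_stable Q by move=> C refQ; exact/stuck/StepSplit/refQ.
  case: old stuck => [Q0|] stuck; last by case: (stuck _ (StepInitialDone stQ)).
  have [eQ|neQ] := pselect (Q = Q0).
    by case: (stuck _ (StepRoundUnchanged stQ eQ)).
  by case: (stuck _ (StepRoundChanged stQ neQ)).
- by case: (stuck _ (StepRStabilize K Q)).
Qed.

Lemma run_inv r n : is_run K r n -> config_inv (r n).
Proof.
move=> [r0 stepr]; suff inv i : i <= n -> config_inv (r i) by exact: inv.
elim: i => [_|i IHi lt_in]; first by rewrite r0; exact: adequate_initial.
exact: step_inv (stepr i lt_in) (IHi (ltnW lt_in)).
Qed.

End ESimCorrect.

Theorem theorem3 (AP : Type) (Sigma : finType) (K : kripke AP Sigma) :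
  every_run_terminates K /\
  (forall Q : PR Sigma, is_output K Q ->
     forall s t : Sigma,
       sim_le K s t <->
       (pblock (blocks Q) s, pblock (blocks Q) t) \in ord Q).
Proof.
split=> [|Q [r [n [/run_inv + rn]]]]; first exact: every_run_terminatesP.
by rewrite rn => -[aQ stQ eQ]; exact: stable_sim_leP.
Qed.
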